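(* Let $\mathcal{A}:\mathbb{R}^{m\times n}\to\mathbb{R}^p$ be a linear map, let $X_0\in\mathbb{R}^{m\times n}$ be a matrix of rank $r$, set $b:=\mathcal{A}(X_0)$, and let $$X^*:=\arg\min_{X\in\mathbb{R}^{m\times n}}\ \|X\|_*\quad\text{subject to}\quad \mathcal{A}(X)=b .$$ Suppose that $r\ge 1$ is such that $\delta_{5r}(\mathcal{A})<1/10$. Then $X^*=X_0$ (that is, $X_0$ is the unique minimizer).
   Context: For a matrix $X$, $\|X\|_*$ denotes the nuclear norm (sum of the singular values) and $\|X\|_F$ the Frobenius norm; $\|\mathcal{A}(X)\|$ is the Euclidean norm in $\mathbb{R}^p$. Restricted isometry constant: for a linear map $\mathcal{A}:\mathbb{R}^{m\times n}\to\mathbb{R}^p$, where without loss of generality $m\le n$, and for every integer $s$ with $1\le s\le m$, $\delta_s(\mathcal{A})$ is the smallest number such that $$(1-\delta_s(\mathcal{A}))\|X\|_F\le\|\mathcal{A}(X)\|\le(1+\delta_s(\mathcal{A}))\|X\|_F$$ holds for all matrices $X\in\mathbb{R}^{m\times n}$ of rank at most $s$. *)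

(* Defs.v *)
From HB Require Import structures.
From mathcomp Require Import all_boot all_order all_algebra.
From mathcomp Require Import polyrcf.
From mathcomp Require Import boolp classical_sets reals.
From mathcomp Require Import lra.

Set Implicit Arguments.
Unset Strict Implicit.
Unset Printing Implicit Defensive.

Import Order.TTheory GRing.Theory Num.Theory.

Local Open Scope ring_scope.
Local Open Scope classical_set_scope.

(* Real eigenvalues, repeated according to their algebraic multiplicity. *)
Definition eigenvalues (R : realType) (n : nat) (M : 'M[R]_n) : seq R :=
  flatten [seq nseq (mup x (char_poly M)) x | x <- rootsR (char_poly M)].

(* The square roots of the eigenvalues of X X^T, which is symmetric, so that
   this sequence has m items, all eigenvalues being real. When n < m it only
   differs from the one obtained from X^T X by additional zeros. *)
Definition singular_values (R : realType) (m n : nat) (X : 'M[R]_(m, n)) :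
    seq R :=
  [seq Num.sqrt x | x <- eigenvalues (X *m X^T)].

Definition nuclear_norm (R : realType) (m n : nat) (X : 'M[R]_(m, n)) : R :=
  \sum_(x <- singular_values X) x.

(* The library norm on matrices is the sup norm, hence the next two
   definitions. *)
Definition frobenius_norm (R : realType) (m n : nat) (X : 'M[R]_(m, n)) : R :=
  Num.sqrt (\sum_(i < m) \sum_(j < n) X i j ^+ 2).

Definition euclidean_norm (R : realType) (p : nat) (v : 'cV[R]_p) : R :=
  Num.sqrt (\sum_(i < p) v i 0 ^+ 2).

Definition isometry_bounds (R : realType) (m n p : nat)
    (A : {linear 'M[R]_(m, n) -> 'cV[R]_p}) (s : nat) : set R :=
  [set d | forall X : 'M[R]_(m, n), (\rank X <= s)%N ->
     (1 - d) * frobenius_norm X <= euclidean_norm (A X)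
       <= (1 + d) * frobenius_norm X].

(* The infimum is a minimum for nonzero m, n and s, see ric_min below. *)
Definition ric (R : realType) (m n p : nat)
    (A : {linear 'M[R]_(m, n) -> 'cV[R]_p}) (s : nat) : R :=
  inf (isometry_bounds A s).

Definition nuclear_argmin (R : realType) (m n p : nat)
    (A : {linear 'M[R]_(m, n) -> 'cV[R]_p}) (b : 'cV[R]_p) :
    set 'M[R]_(m, n) :=
  [set X | A X = b /\
     forall Y : 'M[R]_(m, n), A Y = b -> nuclear_norm X <= nuclear_norm Y].

Section RicMin.
Variables (R : realType) (m n p : nat).
Variable A : {linear 'M[R]_(m, n) -> 'cV[R]_p}.

Lemma frobenius_norm_ge0 (X : 'M[R]_(m, n)) : 0 <= frobenius_norm X.
Proof. exact: sqrtr_ge0. Qed.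

Lemma entry_le_frobenius_norm (X : 'M[R]_(m, n)) i j :
  `|X i j| <= frobenius_norm X.
Proof.
rewrite -sqrtr_sqr ler_wsqrtr // (bigD1 i) //= (bigD1 j) //= -addrA lerDl.
by rewrite addr_ge0 ?sumr_ge0 // => k _; rewrite ?sqr_ge0 ?sumr_ge0 // => l _;
  rewrite sqr_ge0.
Qed.

Lemma euclidean_norm_bounded :
  exists2 C : R, 0 <= C &
    forall X, euclidean_norm (A X) <= C * frobenius_norm X.
Proof.
pose c k := \sum_i \sum_j `|A (delta_mx i j) k 0|.
exists (Num.sqrt (\sum_k c k ^+ 2)) => [|X]; first exact: sqrtr_ge0.
have F0 := frobenius_norm_ge0 X.
rewrite -[X in _ * X](ger0_norm F0) -sqrtr_sqr -sqrtrM; last first.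
  by apply: sumr_ge0 => k _; rewrite sqr_ge0.
apply: ler_wsqrtr; rewrite mulr_suml; apply: ler_sum => k _.
rewrite -exprMn -real_normK ?num_real //; apply: lerXn2r.
- by rewrite nnegrE.
- rewrite nnegrE mulr_ge0 //; apply: sumr_ge0 => i _; exact: sumr_ge0.
rewrite [X in A X]matrix_sum_delta linear_sum summxE mulr_suml.
apply: le_trans (ler_norm_sum _ _ _) _; apply: ler_sum => i _.
rewrite linear_sum summxE mulr_suml.
apply: le_trans (ler_norm_sum _ _ _) _; apply: ler_sum => j _.
rewrite linearZ mxE normrM mulrC ler_wpM2l //.
exact: entry_le_frobenius_norm.
Qed.

Lemma isometry_bounds_nonempty s : isometry_bounds A s !=set0.
Proof.
have [C C0 leC] := euclidean_norm_bounded.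
exists (1 + C) => X _; have F0 := frobenius_norm_ge0 X.
apply/andP; split.
- apply: le_trans (sqrtr_ge0 _); rewrite opprD addNKr.
  by rewrite mulNr oppr_le0 mulr_ge0.
- apply: le_trans (leC X) _; rewrite ler_wpM2r //; lra.
Qed.

Lemma ric_min s : (0 < m)%N -> (0 < n)%N -> (0 < s)%N ->
  isometry_bounds A s (ric A s) /\ lbound (isometry_bounds A s) (ric A s).
Proof.
move=> m0 n0 s0; have ne := isometry_bounds_nonempty s.
pose E : 'M[R]_(m, n) := delta_mx (Ordinal m0) (Ordinal n0).
split; last first.
  apply: ge_inf; exists 0 => d /(_ E).
  rewrite mxrank_delta => /(_ s0) /andP[le1 le2].
  have FE : 0 < frobenius_norm E.
    apply: lt_le_trans (entry_le_frobenius_norm E (Ordinal m0) (Ordinal n0)).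
    by rewrite mxE !eqxx normr1.
  have := le_trans le1 le2; rewrite ler_pM2r //; lra.
move=> X rX; have := frobenius_norm_ge0 X.
rewrite le_eqVlt => /predU1P[F0|F0].
  by have [d /(_ X rX)] := ne; rewrite -F0 !mulr0.
apply/andP; split.
- rewrite -ler_pdivlMr // lerBlDr -lerBlDl.
  apply: lb_le_inf => // d /(_ X rX) /andP[+ _].
  by rewrite -ler_pdivlMr // lerBlDr -lerBlDl.
- rewrite -ler_pdivrMr // -lerBlDl.
  apply: lb_le_inf => // d /(_ X rX) /andP[_].
  by rewrite -ler_pdivrMr // -lerBlDl.
Qed.

End RicMin.

(* Main.v *)
Require Import Defs.
From mathcomp Require Import all_boot all_order all_algebra.
From mathcomp Require Import polyrcf complex.
From mathcomp Require Import boolp classical_sets reals.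
From mathcomp Require Import ring lra.

Set Implicit Arguments.
Unset Strict Implicit.
Unset Printing Implicit Defensive.

Import Order.TTheory GRing.Theory Num.Theory.

Local Open Scope ring_scope.
Local Open Scope classical_set_scope.

(** The minimizer is unique because an error direction [H = Y - X0] with
[A H = 0] cannot decrease the nuclear norm unless it vanishes.

Split [H = H0 + Hc], where [Hc] is the part of [H] whose row and column spaces
are orthogonal to those of [X0] ([tangent_decomposition]); [H0] then has rank at
most [2r].  The nuclear norm is additive on [X0 + Hc], so if [Y = X0 + Hc + H0]
is no larger than [X0] in nuclear norm, the triangle inequality yields the cone
condition: the nuclear norm of [Hc] is at most that of [H0]
([nuclear_norm_add_orthogonal]).

Sort the singular values of [Hc] decreasingly, cut them into blocks of length
[3r], and let [H1] be the part of [Hc] carried by the first block.  Every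
singular value of a block is at most the average over the preceding block, so
the Frobenius norms of all blocks but the first add up to at most the nuclear
norm of [Hc] divided by [sqrt (3r)].  With [A] expanding matrices of rank at
most [3r] by at most 11/10, this bounds [A (Hc - H1)] ([block_decomposition]).
Since [A H = 0], the same quantity bounds [A (H0 + H1)], whose argument has rank
at most [5r] and Frobenius norm at least that of [H0], the two summands being
orthogonal.  As [H0] has rank at most [2r], its nuclear norm is at most
[sqrt (2r)] times its Frobenius norm [F].  Altogether
  [9/10 F <= 11/10 sqrt (2/3) F],
and since [11/10 sqrt (2/3) < 9/10] this forces [F = 0], so [H0 = 0], and then
[Hc = 0] by the cone condition ([nuclear_recovery]).

The facts about the nuclear norm rest on two tools.  The first is a
diagonalization [P X X^T P^T = diag (s^2)] with [P] orthogonal ([left_svd]),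
which comes from the spectral theorem for real symmetric matrices and is tied to
the nuclear norm through the characteristic polynomial.  The second is duality:
the nuclear norm of [X] is the maximum of the trace pairing of [X] with partial
isometries ([inner_le_nuclear_norm], [polar_factor]). *)

(** * The real spectral theorem *)

(** Over the complex numbers the matrix becomes Hermitian, hence it has an
eigenvalue, which is real and is therefore a root of the original characteristic
polynomial. *)
Lemma symmetric_eigenvalue (R : rcfType) (n : nat) (M : 'M[R]_n.+1) :
  M^T = M -> exists a, eigenvalue M a.
Proof.
move=> symM; pose MC := map_mx (real_complex R) M.
have rMC : MC \is a mxOver Num.real.
  by apply/mxOverP => i j; rewrite mxE complex_real.
have sMC : MC \is symmetricmx.
  by apply/is_hermitianmxP; rewrite expr0 scale1r map_mx_id // map_trmx symM.
have hMC := realsym_hermsym sMC rMC.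
have /mxOverP/(_ 0 0) /complex_realP[a da] := hermitian_spectral_diag_real hMC.
exists a; rewrite eigenvalue_root_char -(fmorph_root (real_complex R)).
rewrite map_char_poly -/MC -eigenvalue_root_char.
have /orthomx_spectralP eMC := hermitian_normalmx hMC.
have uP := spectral_unit MC; set P := spectralmx MC in eMC uP.
apply/eigenvalueP; exists (row 0 P).
  rewrite eMC -row_mul !mulmxA mulmxV // mul1mx.
  rewrite row_mul row_diag_mx -scalemxAl -rowE.
  by rewrite da.
apply/eqP => P0; have : row 0 P *m invmx P = 0 by rewrite P0 mul0mx.
rewrite -row_mul mulmxV // => /rowP/(_ 0).
by rewrite !mxE eqxx => /eqP; rewrite oner_eq0.
Qed.

Lemma row_mul_trE (R : comNzRingType) (n : nat) (u : 'rV[R]_n) :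
  u *m u^T = (\sum_i u 0 i ^+ 2)%:M.
Proof.
apply/matrixP => i j; rewrite !ord1 !mxE eqxx mulr1n.
by apply: eq_bigr => k _; rewrite mxE -expr2.
Qed.

Lemma sum_sqr_row_eq0 (R : realDomainType) (n : nat) (u : 'rV[R]_n) :
  (\sum_i u 0 i ^+ 2 == 0) = (u == 0).
Proof.
apply/idP/eqP => [|->]; last first.
  by rewrite big1 // => i _; rewrite mxE expr0n.
rewrite psumr_eq0 => [/allP u0|i _]; last exact: sqr_ge0.
apply/rowP => i; rewrite [RHS]mxE; apply/eqP.
by have := u0 i (mem_index_enum i); rewrite sqrf_eq0.
Qed.

(** The reflection in the hyperplane orthogonal to [v - e_0] exchanges [e_0] and
[v]; when the two coincide, the identity serves instead.  It completes a unit
vector to an orthogonal basis, which is what the inductive step of the spectral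
theorem needs. *)
Lemma householder (R : rcfType) (n : nat) (v : 'rV[R]_n.+1) :
  v *m v^T = 1%:M ->
  exists H : 'M[R]_n.+1, [/\ H^T = H, H *m H = 1%:M & delta_mx 0 0 *m H = v].
Proof.
move=> vv; pose e : 'rV[R]_n.+1 := delta_mx 0 0.
have [<-|neq_ev] := eqVneq e v.
  by exists 1%:M; rewrite trmx1 !mulmx1.
pose w := v - e.
have ee : e *m e^T = 1%:M.
  by rewrite trmx_delta mul_delta_mx; apply/matrixP => i j; rewrite !ord1 !mxE.
have ev : e *m v^T = (v 0 0)%:M.
  by rewrite -rowE; apply/matrixP => i j; rewrite !ord1 !mxE eqxx mulr1n.
have ve : v *m e^T = (v 0 0)%:M.
  by rewrite -[LHS]trmxK trmx_mul trmxK ev tr_scalar_mx.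
have ww : w *m w^T = (2 * (1 - v 0 0))%:M.
  rewrite /w linearB /= mulmxBl !mulmxBr ee vv ev ve -!raddfB /=.
  by congr _%:M; ring.
have ew : e *m w^T = (v 0 0 - 1)%:M.
  by rewrite /w linearB /= mulmxBr ee ev raddfB.
have v0 : 1 - v 0 0 != 0.
  apply: contra neq_ev => /eqP v01; rewrite eq_sym -subr_eq0 -/w.
  rewrite -sum_sqr_row_eq0; apply/eqP.
  have := row_mul_trE w; rewrite ww v01 mulr0 => /matrixP/(_ 0 0).
  by rewrite !mxE eqxx !mulr1n.
have sH : (1%:M - (1 - v 0 0)^-1 *: (w^T *m w))^T
   = 1%:M - (1 - v 0 0)^-1 *: (w^T *m w).
  by rewrite linearB linearZ /= trmx_mul trmxK trmx1.
exists (1%:M - (1 - v 0 0)^-1 *: (w^T *m w)); split => //.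
  rewrite mulmxBr mulmx1 mulmxBl mul1mx -scalemxAl -scalemxAr.
  rewrite mulmxA -[_ *m w *m w^T]mulmxA ww mul_mx_scalar -scalemxAl !scalerA.
  have -> : (1 - v 0 0)^-1 * ((1 - v 0 0)^-1 * (2 * (1 - v 0 0)))
      = (1 - v 0 0)^-1 + (1 - v 0 0)^-1 by field.
  by rewrite scalerDl opprB addrK addrNK.
rewrite -/e mulmxBr mulmx1 -scalemxAr mulmxA ew mul_scalar_mx scalerA.
by rewrite -[v 0 0 - 1]opprB mulrN mulVf // scaleN1r opprK /w addrC subrK.
Qed.

(** Induction on the dimension: conjugating by the reflection that sends a unit
eigenvector to [e_0] leaves a block-diagonal symmetric matrix. *)
Lemma symmetric_diagonalization (R : rcfType) (n : nat) (M : 'M[R]_n) :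
  M^T = M -> exists2 P : 'M[R]_n, P *m P^T = 1%:M &
    exists d : 'rV[R]_n, M = P^T *m diag_mx d *m P.
Proof.
elim: n M => [|n IHn] M symM.
  by exists 0; [|exists 0]; apply/matrixP => -[].
have [a /eigenvalueP[u uM u0]] := @symmetric_eigenvalue R n M symM.
pose c := \sum_i u 0 i ^+ 2.
have c0 : 0 < c.
  rewrite lt_def sumr_ge0 ?andbT => [|i _]; last exact: sqr_ge0.
  by rewrite sum_sqr_row_eq0.
pose v := (Num.sqrt c)^-1 *: u.
have vM : v *m M = a *: v by rewrite -scalemxAl uM !scalerA mulrC.
have vv : v *m v^T = 1%:M.
  rewrite linearZ /= -scalemxAl -scalemxAr scalerA -invfM -expr2.
  rewrite sqr_sqrtr ?ltW //.
  by rewrite row_mul_trE -/c scale_scalar_mx mulVf ?gt_eqF.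
have [H [sH HH eH]] := @householder R n v vv.
(* M' is abstracted so that mxE reads its entries without expanding the product;
   the type 'M_(1 + n) is what block_mx expects. *)
have [M' M'def] : exists M' : 'M_(1 + n), M' = H *m M *m H.
  by exists (H *m M *m H).
have sM' : M'^T = M' by rewrite M'def !trmx_mul sH symM mulmxA.
have eM' : delta_mx 0 0 *m M' = a *: delta_mx 0 0 :> 'rV_(1 + n).
  rewrite M'def !mulmxA eH vM -scalemxAl -eH -mulmxA HH mulmx1 //.
have M'E : M' = block_mx a%:M 0 0 (drsubmx M').
  have M'0 (i : 'I_1) j : M' (lshift n i) j = a * (j == lshift n 0)%:R.
    have l0 : lshift n (0 : 'I_1) = (0 : 'I_n.+1) by exact: val_inj.
    by rewrite ord1 l0; move/rowP/(_ j): eM'; rewrite -rowE !mxE.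
  rewrite -[LHS]submxK; congr block_mx; apply/matrixP => i j; rewrite !mxE.
  - by rewrite M'0 !ord1 !eqxx mulr1n mulr1.
  - by rewrite M'0 eq_rlshift mulr0.
  - by rewrite -sM' mxE M'0 eq_rlshift mulr0.
have sN : (drsubmx M')^T = drsubmx M' by rewrite trmx_drsub sM'.
have [Q QQ [d dE]] := IHn _ sN.
pose B : 'M_(1 + n) := block_mx 1%:M 0 0 Q.
have BB : B *m B^T = 1%:M.
  rewrite /B tr_block_mx mulmx_block.
  rewrite !(mulmx0, mul0mx, addr0, add0r, trmx0, trmx1, mulmx1).
  by rewrite QQ -scalar_mx_block.
have M'B : M' = B^T *m diag_mx (row_mx a%:M d) *m B.
  rewrite M'E /B diag_mx_row tr_block_mx !mulmx_block.
  rewrite !(mulmx0, mul0mx, addr0, add0r, trmx0, trmx1, mulmx1, mul1mx) -dE.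
  by congr block_mx; apply/matrixP => i j; rewrite !ord1 !mxE eqxx.
exists (B *m H : 'M_(1 + n)).
  by rewrite trmx_mul sH mulmxA -[_ *m H *m H]mulmxA HH mulmx1.
exists (row_mx a%:M d : 'rV_(1 + n)).
have -> : M = H *m M' *m H.
  by rewrite M'def !mulmxA HH mul1mx -mulmxA HH mulmx1.
by rewrite M'B trmx_mul sH !mulmxA.
Qed.

Lemma char_poly_orthogonal (R : comUnitRingType) (n : nat) (P M : 'M[R]_n) :
  P *m P^T = 1%:M -> char_poly (P^T *m M *m P) = char_poly M.
Proof.
move=> PP; rewrite /char_poly /char_poly_mx.
have PP' : map_mx polyC P^T *m map_mx polyC P = 1%:M.
  by rewrite -map_mxM /= (mulmx1C PP) map_mx1.
have -> : 'X%:M - map_mx polyC (P^T *m M *m P) =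
    map_mx polyC P^T *m ('X%:M - map_mx polyC M) *m map_mx polyC P.
  rewrite mulmxBr mulmxBl !map_mxM; congr (_ - _).
  by rewrite scalar_mxC -mulmxA PP' mulmx1.
rewrite !det_mulmx mulrAC -det_mulmx.
by rewrite PP' det1 mul1r.
Qed.

(** Both sequences contain each [x] as often as its multiplicity as a root of the
characteristic polynomial. *)
Lemma perm_eigenvalues (R : realType) (n : nat) (M : 'M[R]_n) (d : seq R) :
  char_poly M = \prod_(x <- d) ('X - x%:P) -> perm_eq (eigenvalues M) d.
Proof.
move=> Md; apply/allP => x _ /=; apply/eqP.
have M0 : char_poly M != 0 by rewrite monic_neq0 // char_poly_monic.
rewrite /eigenvalues.
have -> : count_mem x (flatten [seq nseq (mup y (char_poly M)) y
    | y <- rootsR (char_poly M)]) = mup x (char_poly M).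
  rewrite count_flatten -map_comp sumnE big_map.
  under eq_bigr => y _ do rewrite /= count_nseq /=.
  have [rx|rx] := boolP (x \in rootsR (char_poly M)).
    rewrite (bigD1_seq x) ?uniq_roots //= eqxx mul1n big1 ?addn0 //.
    by move=> y /negPf; rewrite eq_sym => ->.
  rewrite big_seq big1 ?mupNroot // => [|y ry].
    by have := roots_on_rootsR M0 x; rewrite (negPf rx) /= => ->.
  by case: eqP ry rx => [-> ->|].
rewrite Md; elim: d {Md M0} => [|y d IHd].
  by rewrite big_nil mupNroot // root1.
have pr0 : \prod_(x <- d) ('X - x%:P) != 0.
  by rewrite monic_neq0 // monic_prod_XsubC.
rewrite big_cons mupM ?polyXsubC_eq0 //= IHd; congr addn.
by rewrite -['X - _]expr1 mup_XsubCX eq_sym; case: eqP.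
Qed.

(** * The trace inner product and the Frobenius norm *)

Definition inner (R : realType) (m n : nat) (X Y : 'M[R]_(m, n)) : R :=
  \tr (X *m Y^T).

Section Inner.
Variables (R : realType) (m n : nat).
Implicit Types X Y : 'M[R]_(m, n).

Lemma inner_sum X Y : inner X Y = \sum_i \sum_j X i j * Y i j.
Proof.
by apply: eq_bigr => i _; rewrite mxE; apply: eq_bigr => j _; rewrite mxE.
Qed.

Lemma innerC X Y : inner X Y = inner Y X.
Proof. by rewrite /inner -mxtrace_tr trmx_mul trmxK. Qed.

Lemma innerDl X Y Z : inner (X + Y) Z = inner X Z + inner Y Z.
Proof. by rewrite /inner mulmxDl raddfD. Qed.

Lemma innerDr X Y Z : inner X (Y + Z) = inner X Y + inner X Z.
Proof. by rewrite innerC innerDl !(innerC _ X). Qed.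

Lemma innerZl a X Y : inner (a *: X) Y = a * inner X Y.
Proof. by rewrite /inner -scalemxAl mxtraceZ. Qed.

Lemma innerZr a X Y : inner X (a *: Y) = a * inner X Y.
Proof. by rewrite innerC innerZl innerC. Qed.

Lemma frobenius_norm_sqr X : frobenius_norm X ^+ 2 = inner X X.
Proof.
rewrite sqr_sqrtr ?inner_sum.
  by apply: eq_bigr => i _; apply: eq_bigr => j _; rewrite expr2.
by apply: sumr_ge0 => i _; apply: sumr_ge0 => j _; exact: sqr_ge0.
Qed.

Lemma frobenius_norm_eq0 X : frobenius_norm X = 0 -> X = 0.
Proof.
move=> X0; apply/matrixP => i j; rewrite [RHS]mxE; apply/eqP.
by rewrite -normr_le0 -X0 entry_le_frobenius_norm.
Qed.

Lemma frobenius_normN X : frobenius_norm (- X) = frobenius_norm X.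
Proof.
apply/eqP; rewrite -(@eqrXn2 _ 2) ?frobenius_norm_ge0 //.
by rewrite !frobenius_norm_sqr -scaleN1r innerZl innerZr !mulN1r opprK.
Qed.

Lemma inner_le X Y : inner X Y <= frobenius_norm X * frobenius_norm Y.
Proof.
have X0 := frobenius_norm_ge0 X; have Y0 := frobenius_norm_ge0 Y.
have [Yeq|Ypos] := eqVneq (frobenius_norm Y) 0.
  by rewrite Yeq mulr0 (frobenius_norm_eq0 Yeq) /inner trmx0 mulmx0 mxtrace0.
have {Ypos}Y1 : 0 < frobenius_norm Y by rewrite lt_def Ypos.
(* Expanding the norm of the component of X orthogonal to Y, scaled by
   |Y|^2 to avoid the division. *)
have lagrange : frobenius_norm (inner Y Y *: X - inner X Y *: Y) ^+ 2 =
    frobenius_norm Y ^+ 2 *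
      ((frobenius_norm X * frobenius_norm Y) ^+ 2 - inner X Y ^+ 2).
  rewrite exprMn !frobenius_norm_sqr -scaleNr.
  by rewrite !(innerDl, innerDr, innerZl, innerZr) (innerC Y X); ring.
have := sqr_ge0 (frobenius_norm (inner Y Y *: X - inner X Y *: Y)).
rewrite lagrange.
rewrite pmulr_rge0 ?exprn_gt0 // subr_ge0 => zxy.
rewrite (le_trans (ler_norm _)) // -ler_sqr ?nnegrE ?mulr_ge0 //.
by rewrite real_normK ?num_real.
Qed.

Lemma frobenius_normD X Y :
  frobenius_norm (X + Y) <= frobenius_norm X + frobenius_norm Y.
Proof.
rewrite -ler_sqr ?nnegrE ?addr_ge0 ?frobenius_norm_ge0 //.
rewrite frobenius_norm_sqr !(innerDl, innerDr) (innerC Y X) sqrrD.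
rewrite -!frobenius_norm_sqr mulr2n.
by have := inner_le X Y; lra.
Qed.

Lemma frobenius_norm_le_orthogonal X Y :
  inner X Y = 0 -> frobenius_norm X <= frobenius_norm (X + Y).
Proof.
move=> XY; rewrite -ler_sqr ?nnegrE ?frobenius_norm_ge0 //.
rewrite [leRHS]frobenius_norm_sqr !(innerDl, innerDr) (innerC Y X) XY.
by rewrite addr0 add0r -!frobenius_norm_sqr lerDl sqr_ge0.
Qed.

End Inner.

Lemma euclidean_normE (R : realType) (p : nat) (v : 'cV[R]_p) :
  euclidean_norm v = frobenius_norm v.
Proof.
by congr Num.sqrt; apply: eq_bigr => i _; rewrite big_ord1.
Qed.

(** * Partial isometries *)

Definition partial_isometry (R : realType) (m n : nat) (W : 'M[R]_(m, n)) :=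
  W *m W^T *m W = W.

(** [T = W W^T] is an orthogonal projection, so [|z W|^2 = |z T|^2] and the
difference of the two squared norms is [|z - z T|^2]. *)
Lemma partial_isometry_contraction (R : realType) (m n : nat)
    (W : 'M[R]_(m, n)) (z : 'rV[R]_m) :
  partial_isometry W -> frobenius_norm (z *m W) <= frobenius_norm z.
Proof.
move=> WW; rewrite -ler_sqr ?nnegrE ?frobenius_norm_ge0 // -subr_ge0.
pose T := W *m W^T.
have zW : inner (z *m W) (z *m W) = inner (z *m T) z.
  by rewrite /inner trmx_mul !mulmxA.
have zT : inner (z *m T) (z *m T) = inner (z *m T) z.
  by rewrite /inner !trmx_mul trmxK !mulmxA -!(mulmxA z) WW.
have -> : frobenius_norm z ^+ 2 - frobenius_norm (z *m W) ^+ 2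
    = frobenius_norm (z - z *m T) ^+ 2.
  rewrite !frobenius_norm_sqr -scaleN1r !(innerDl, innerDr, innerZl, innerZr).
  by rewrite zT zW (innerC z (z *m T)); ring.
exact: sqr_ge0.
Qed.

Lemma inner_rows (R : realType) (m n : nat) (X Y : 'M[R]_(m, n)) :
  inner X Y = \sum_i inner (row i X) (row i Y).
Proof.
rewrite inner_sum; apply: eq_bigr => i _; rewrite inner_sum big_ord1.
by apply: eq_bigr => j _; rewrite !mxE.
Qed.

Lemma mul_tr_diag (R : realType) (m n : nat) (X : 'M[R]_(m, n)) i :
  (X *m X^T) i i = frobenius_norm (row i X) ^+ 2.
Proof.
rewrite frobenius_norm_sqr inner_sum big_ord1 mxE.
by apply: eq_bigr => j _; rewrite !mxE.
Qed.

(** * Singular value decomposition and the nuclear norm *)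

(** A singular value decomposition in which only the left singular vectors, the
rows of [P], are normalized: the rows of [P X] are pairwise orthogonal and have
norms [s i].  Normalizing them as well would require completing them when some
[s i] vanish. *)
Definition left_svd (R : realType) (m n : nat) (X : 'M[R]_(m, n))
    (P : 'M[R]_m) (s : 'I_m -> R) :=
  [/\ P *m P^T = 1%:M, forall i, 0 <= s i &
      P *m X *m (P *m X)^T = diag_mx (\row_i s i ^+ 2)].

Lemma left_svd_exists (R : realType) (m n : nat) (X : 'M[R]_(m, n)) :
  exists P s, left_svd X P s.
Proof.
have [P PP [d Xd]] : exists2 P : 'M[R]_m, P *m P^T = 1%:M &
    exists d : 'rV[R]_m, X *m X^T = P^T *m diag_mx d *m P.
  by apply: symmetric_diagonalization; rewrite trmx_mul trmxK.
exists P, (fun i => Num.sqrt (d 0 i)); split => // [i|]; first exact: sqrtr_ge0.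
have PXd : P *m X *m (P *m X)^T = diag_mx d.
  rewrite trmx_mul !mulmxA -(mulmxA P) Xd !mulmxA PP mul1mx.
  by rewrite -mulmxA PP mulmx1.
rewrite PXd; congr diag_mx; apply/rowP => i; rewrite [RHS]mxE sqr_sqrtr //.
have -> : d 0 i = (P *m X *m (P *m X)^T) i i by rewrite PXd mxE eqxx mulr1n.
by rewrite mul_tr_diag sqr_ge0.
Qed.

Section LeftSvd.
Variables (R : realType) (m n : nat) (X : 'M[R]_(m, n)) (P : 'M[R]_m).
Variable s : 'I_m -> R.
Hypothesis Xs : left_svd X P s.

Let PP : P *m P^T = 1%:M. Proof. by case: Xs. Qed.
Let PtP : P^T *m P = 1%:M. Proof. exact: mulmx1C. Qed.
Let s0 i : 0 <= s i. Proof. by case: Xs. Qed.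
Let PX : P *m X *m (P *m X)^T = diag_mx (\row_i s i ^+ 2).
Proof. by case: Xs. Qed.

Lemma gram_svd : X *m X^T = P^T *m (diag_mx (\row_i s i ^+ 2) *m P).
Proof. by rewrite -PX trmx_mul !mulmxA PtP mul1mx -mulmxA PtP mulmx1. Qed.

Lemma nuclear_norm_svd : nuclear_norm X = \sum_i s i.
Proof.
have pe : perm_eq (eigenvalues (X *m X^T)) [seq s i ^+ 2 | i <- enum 'I_m].
  apply: perm_eigenvalues; rewrite gram_svd mulmxA char_poly_orthogonal //.
  rewrite char_poly_trig ?diag_mx_is_trig // big_map big_enum /=.
  by apply: eq_bigr => i _; rewrite !mxE eqxx mulr1n.
rewrite /nuclear_norm /singular_values (perm_big _ (perm_map Num.sqrt pe)).
rewrite -map_comp big_map big_enum /=.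
by apply: eq_bigr => i _; rewrite /= sqrtr_sqr ger0_norm.
Qed.

Lemma row_svd_norm i : frobenius_norm (row i (P *m X)) = s i.
Proof.
apply/eqP; rewrite -(@eqrXn2 _ 2) ?frobenius_norm_ge0 //.
by rewrite -mul_tr_diag PX !mxE eqxx mulr1n.
Qed.

(** In the orthonormal basis given by the rows [p_i] of [P], the pairing is the
sum of the inner products of [p_i W], of norm at most 1, with [p_i X], of norm
[s i]. *)
Lemma inner_le_nuclear (W : 'M[R]_(m, n)) :
  partial_isometry W -> inner W X <= nuclear_norm X.
Proof.
move=> isoW; have -> : inner W X = inner (P *m W) (P *m X).
  rewrite /inner trmx_mul -mulmxA [RHS]mxtrace_mulC.
  by rewrite -!mulmxA PtP mulmx1.
rewrite inner_rows nuclear_norm_svd; apply: ler_sum => i _.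
apply: le_trans (inner_le _ _) _; rewrite row_svd_norm ler_piMl // row_mul.
apply: le_trans (partial_isometry_contraction _ isoW) _.
rewrite -(@ler_pXn2r _ 2) ?nnegrE ?frobenius_norm_ge0 // expr1n.
by rewrite -mul_tr_diag PP mxE eqxx.
Qed.

(** With [p_i] the rows of [P], [X] is the sum of the rank-one matrices
[p_i^T (p_i X)]; here the i-th one is multiplied by [f i].  Indicator functions
[f] give the blocks of [X], and [f i = (s i)^-1] gives its polar factor. *)
Definition reweight (f : 'I_m -> R) : 'M[R]_(m, n) :=
  P^T *m (diag_mx (\row_i f i) *m (P *m X)).

Lemma diag_mxM (f g : 'I_m -> R) :
  diag_mx (\row_i f i) *m diag_mx (\row_i g i) = diag_mx (\row_i (f i * g i)).
Proof. by rewrite mulmx_diag; congr diag_mx; apply/rowP => i; rewrite !mxE. Qed.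

Lemma reweight_mul_tr f g : reweight f *m (reweight g)^T =
  P^T *m (diag_mx (\row_i (f i * s i ^+ 2 * g i)) *m P).
Proof.
rewrite /reweight; move: (P *m X) PX => Y YY.
rewrite !trmx_mul trmxK tr_diag_mx -!mulmxA.
by rewrite (mulmxA Y) YY (mulmxA (diag_mx _) (diag_mx _)) diag_mxM
  (mulmxA (diag_mx _) (diag_mx _)) diag_mxM.
Qed.

Lemma reweight_mul3 f g h : reweight f *m (reweight g)^T *m reweight h =
  reweight (fun i => f i * s i ^+ 2 * g i * h i).
Proof.
rewrite reweight_mul_tr /reweight -!mulmxA (mulmxA P) PP mul1mx.
by rewrite (mulmxA (diag_mx _) (diag_mx _)) diag_mxM.
Qed.

Lemma inner_reweight f g :
  inner (reweight f) (reweight g) = \sum_i f i * s i ^+ 2 * g i.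
Proof.
rewrite /inner reweight_mul_tr mxtrace_mulC -mulmxA PP mulmx1 mxtrace_diag.
by apply: eq_bigr => i _; rewrite mxE.
Qed.

(** The i-th row of [P X] has norm [s i], so the weight [f i] is irrelevant when
[s i = 0]. *)
Lemma eq_reweight f g : (forall i, s i != 0 -> f i = g i) ->
  reweight f = reweight g.
Proof.
move=> fg; congr (_ *m _); apply/row_matrixP => i.
rewrite !(row_mul, row_diag_mx) -!scalemxAl -rowE !mxE.
have [si0|/fg-> //] := eqVneq (s i) 0.
have := row_svd_norm i; rewrite si0 => /frobenius_norm_eq0 ->.
by rewrite !scaler0.
Qed.

Lemma reweight1 : reweight (fun=> 1) = X.
Proof.
rewrite /reweight (_ : \row_i _ = const_mx 1) => [|]; last first.
  by apply/rowP => i; rewrite !mxE.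
by rewrite diag_const_mx mul1mx mulmxA PtP mul1mx.
Qed.

Lemma reweightD f g :
  reweight (fun i => f i + g i) = reweight f + reweight g.
Proof.
rewrite /reweight -mulmxDr -mulmxDl -raddfD; congr (_ *m (diag_mx _ *m _)).
by apply/rowP => i; rewrite !mxE.
Qed.

(** Row and column spaces of a reweighting of [X] lie in those of [X].  The
factorization expresses both inclusions at once, so that orthogonality to [X] is
inherited by its blocks and by its polar factor. *)
Lemma reweight_sandwich f : exists M, reweight f = X *m M *m X.
Proof.
exists (X^T *m (P^T *m (diag_mx (\row_i (f i / s i ^+ 2)) *m P))).
rewrite -!mulmxA (mulmxA X X^T) gram_svd -!mulmxA (mulmxA P P^T) PP mul1mx.
rewrite (mulmxA (diag_mx _) (diag_mx _)) diag_mxM.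
apply: eq_reweight => i si0; rewrite mulrCA mulfV ?mulr1 //.
by rewrite expf_neq0.
Qed.

Lemma rank_diag_le (f : 'I_m -> R) :
  (\rank (diag_mx (\row_i f i)) <= #|[set i | f i != 0%R]%SET|)%N.
Proof.
rewrite diag_mx_sum_delta (bigID (fun i => f i != 0)) /=.
rewrite [X in _ + X]big1 ?addr0.
  rewrite -sum1dep_card.
  elim/big_rec2: _ => [|i k A fi IH]; first by rewrite mxrank0.
  apply: leq_trans (mxrank_add _ _) _; apply: leq_add IH.
  by apply: leq_trans (mxrank_scale _ _) _; rewrite mxrank_delta.
by move=> i; rewrite negbK mxE => /eqP->; rewrite scale0r.
Qed.

Lemma rank_reweight (f : 'I_m -> R) :
  (\rank (reweight f) <= #|[set i | f i != 0%R]%SET|)%N.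
Proof.
apply: leq_trans (mxrankM_maxr _ _) _; apply: leq_trans (mxrankM_maxl _ _) _.
exact: rank_diag_le.
Qed.

(** The diagonal matrix [D] of the squared singular values has rank at most that
of [X].  Adding the indicator [E] of the vanishing ones makes it invertible, so
the ranks of [D] and [E] add up to at least [m]. *)
Lemma card_support_le_rank : (#|[set i | s i != 0%R]%SET| <= \rank X)%N.
Proof.
pose D : 'M[R]_m := diag_mx (\row_i s i ^+ 2).
pose E : 'M[R]_m := diag_mx (\row_i (s i == 0)%:R).
have rD : (\rank D <= \rank X)%N.
  rewrite /D -PX; apply: leq_trans (mxrankM_maxl _ _) _; exact: mxrankM_maxr.
have rE : (\rank E <= #|[set i | s i == 0%R]%SET|)%N.
  apply: leq_trans (rank_diag_le _) _; apply/eq_leq/eq_card => i.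
  by rewrite !inE pnatr_eq0 eqb0 negbK.
have DE : \rank (D + E)%R = m.
  have -> : D + E = diag_mx (\row_i (s i ^+ 2 + (s i == 0)%:R)).
    by apply/matrixP => i j; rewrite !mxE mulrnDl.
  apply: mxrank_unit.
  rewrite unitmxE det_diag unitfE; apply/prodf_neq0 => i _; rewrite mxE.
  have [->|si] := eqVneq (s i) 0; first by rewrite expr0n add0r oner_eq0.
  by rewrite addr0 expf_neq0.
have : (m <= \rank X + #|[set i | s i == 0%R]%SET|)%N.
  rewrite -{1}DE; apply: leq_trans (mxrank_add _ _) _; exact: leq_add.
rewrite -{1}(card_ord m) -(cardsC [set i | s i == 0%R]%SET) addnC leq_add2r.
by apply: leq_trans; apply/eq_leq/eq_card => i; rewrite !inE.
Qed.

End LeftSvd.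

(** The partial isometry [W] of the polar decomposition of [X] attains the dual
bound; [W W^T] and [W^T W] are the orthogonal projections on the column and row
spaces of [X].  The convention [0^-1 = 0] makes [f i = (s i)^-1] the right weight
also at vanishing singular values. *)
Lemma polar_factor (R : realType) (m n : nat) (X : 'M[R]_(m, n)) :
  exists W : 'M[R]_(m, n),
    [/\ partial_isometry W, inner W X = nuclear_norm X,
        W *m W^T *m X = X /\ X *m W^T *m W = X,
        exists M, W = X *m M *m X & frobenius_norm W ^+ 2 <= (\rank X)%:R].
Proof.
have [P [s Xs]] := left_svd_exists X.
have X1 := reweight1 Xs.
exists (reweight X P (fun i => (s i)^-1)); split.
- rewrite /partial_isometry (reweight_mul3 Xs); apply: (eq_reweight Xs) => i si.
  by field.
- rewrite -{2}X1 (inner_reweight Xs) (nuclear_norm_svd Xs).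
  apply: eq_bigr => i _; rewrite mulr1.
  by have [->|si] := eqVneq (s i) 0; [rewrite invr0 mul0r|field].
- split; rewrite -[RHS]X1.
    rewrite -[X in _ *m X = _]X1 (reweight_mul3 Xs).
    by apply: (eq_reweight Xs) => i si; field.
  rewrite -[X in X *m _ *m _ = _]X1 (reweight_mul3 Xs).
  by apply: (eq_reweight Xs) => i si; field.
- exact: (reweight_sandwich Xs).
- apply: le_trans (_ : #|[set i | s i != 0%R]%SET|%:R <= _); last first.
    by rewrite ler_nat (card_support_le_rank Xs).
  rewrite frobenius_norm_sqr (inner_reweight Xs) -sum1dep_card natr_sum.
  rewrite (bigID (fun i => s i != 0)) /= [X in _ + X]big1 ?addr0.
    by apply: ler_sum => i si; rewrite (_ : _ * _ = 1) //; field.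
  by move=> i; rewrite negbK => /eqP ->; rewrite invr0 mulr0.
Qed.

(** Cauchy-Schwarz for the pairing of [X] with its polar factor, whose squared
Frobenius norm is at most the rank of [X]. *)
Lemma nuclear_norm_le_frobenius (R : realType) (m n : nat) (X : 'M[R]_(m, n)) :
  nuclear_norm X <= Num.sqrt (\rank X)%:R * frobenius_norm X.
Proof.
have [W [_ <- _ _ WX]] := polar_factor X.
apply: le_trans (inner_le _ _) _; rewrite ler_wpM2r ?frobenius_norm_ge0 //.
by rewrite -[leLHS]ger0_norm ?frobenius_norm_ge0 // -sqrtr_sqr ler_wsqrtr.
Qed.

Lemma inner_le_nuclear_norm (R : realType) (m n : nat) (W X : 'M[R]_(m, n)) :
  partial_isometry W -> inner W X <= nuclear_norm X.
Proof.
by have [P [s Xs]] := left_svd_exists X; exact: (inner_le_nuclear Xs).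
Qed.

Lemma nuclear_normN (R : realType) (m n : nat) (X : 'M[R]_(m, n)) :
  nuclear_norm (- X) = nuclear_norm X.
Proof.
by rewrite /nuclear_norm /singular_values linearN /= mulmxN mulNmx opprK.
Qed.

(** When the row spaces and the column spaces of [X] and [Y] are orthogonal, the
sum of their polar factors is again a partial isometry; it pairs with [X + Y] to
the sum of the two nuclear norms, and with [Z] to at least minus the nuclear norm
of [Z]. *)
Lemma nuclear_norm_add_orthogonal (R : realType) (m n : nat)
    (X Y Z : 'M[R]_(m, n)) :
  X^T *m Y = 0 -> X *m Y^T = 0 ->
  nuclear_norm X + nuclear_norm Y <= nuclear_norm (X + Y + Z) + nuclear_norm Z.
Proof.
move=> XtY XYt.
have YtX : Y^T *m X = 0 by rewrite -[X]trmxK -trmx_mul XtY trmx0.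
have YXt : Y *m X^T = 0 by rewrite -[Y]trmxK -trmx_mul XYt trmx0.
have [U [isoU UX _ [M UE] _]] := polar_factor X.
have [V [isoV VY _ [N VE] _]] := polar_factor Y.
have UVt : U *m V^T = 0.
  by rewrite UE VE !trmx_mul -!mulmxA (mulmxA X Y^T) XYt mul0mx !mulmx0.
have VUt : V *m U^T = 0 by rewrite -[V]trmxK -trmx_mul UVt trmx0.
have UtV : U^T *m V = 0.
  by rewrite UE VE !trmx_mul -!mulmxA (mulmxA X^T Y) XtY mul0mx !mulmx0.
have VtU : V^T *m U = 0 by rewrite -[U]trmxK -trmx_mul UtV trmx0.
have isoUV : partial_isometry (U + V).
  rewrite /partial_isometry; have -> : (U + V)^T = U^T + V^T by rewrite linearD.
  rewrite [(U + V) *m _]mulmxDl !mulmxDr UVt VUt addr0 add0r !mulmxDl.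
  rewrite -[U *m U^T *m V]mulmxA -[V *m V^T *m U]mulmxA UtV VtU !mulmx0.
  by rewrite addr0 add0r isoU isoV.
have inUY : inner U Y = 0.
  by rewrite /inner UE -!mulmxA XYt !mulmx0 mxtrace0.
have inVX : inner V X = 0.
  by rewrite /inner VE -!mulmxA YXt !mulmx0 mxtrace0.
have := inner_le_nuclear_norm (X + Y + Z) isoUV.
have := inner_le_nuclear_norm (- Z) isoUV.
rewrite nuclear_normN -scaleN1r innerZr !(innerDl, innerDr) UX VY inUY inVX.
lra.
Qed.

Lemma nuclear_norm_eq0 (R : realType) (m n : nat) (X : 'M[R]_(m, n)) :
  nuclear_norm X <= 0 -> X = 0.
Proof.
have [P [s Xs]] := left_svd_exists X; rewrite (nuclear_norm_svd Xs) => le0.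
have s0 i : 0 <= s i by case: Xs.
rewrite -(reweight1 Xs) -[0](mulmx0 _ P^T) -[in RHS](mul0mx _ (P *m X)).
rewrite -(eq_reweight Xs (f := fun=> 0)).
  rewrite /reweight (_ : \row_i _ = 0) ?raddf0 //.
  by apply/rowP => i; rewrite !mxE.
move=> i; have : \sum_i s i == 0 by rewrite eq_le le0 sumr_ge0.
by rewrite psumr_eq0 // => /allP/(_ i (mem_index_enum i))/eqP-> /eqP.
Qed.

(** * Cutting the singular values into blocks *)

Lemma top_subset (R : realDomainType) (I : finType) (a : I -> R)
    (S : {set I}) k :
  (k <= #|S|)%N -> exists T : {set I}, [/\ T \subset S, #|T| = k &
    forall i j, i \in T -> j \in S :\: T -> a j <= a i].
Proof.
elim: k => [|k IHk] kS.
  exists finset.set0; split; rewrite ?finset.sub0set ?cards0 // => i j.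
  by rewrite finset.in_set0.
have [T [TS Tk Ta]] := IHk (ltnW kS).
have [i0 i0ST] : exists i, i \in S :\: T.
  by apply/set0Pn; rewrite -card_gt0 cardsD (finset.setIidPr TS) Tk subn_gt0.
pose i1 := [arg max_(i > i0 in S :\: T) a i]%O.
have [i1ST i1a] : i1 \in S :\: T /\ forall j, j \in S :\: T -> a j <= a i1.
  by rewrite /i1; case: arg_maxP.
have [i1T i1S] : i1 \notin T /\ i1 \in S.
  by move: i1ST; rewrite finset.in_setD => /andP.
exists (i1 |: T)%SET; split.
- by rewrite finset.subUset finset.sub1set i1S.
- by rewrite cardsU1 i1T Tk.
- move=> i j; rewrite in_setU1 finset.in_setD in_setU1 negb_or.
  move=> /orP[/eqP-> | iT] /andP[/andP[_ jT] jS].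
    by apply: i1a; rewrite finset.in_setD jT.
  by apply: Ta; rewrite // finset.in_setD jT.
Qed.

(** Remove from [S] its [k] largest values [T] and recurse.  Every value of the
next block [U] is at most the average over [T], so the Euclidean norm of [U] is
at most the sum over [T] divided by [sqrt k].  Summing over the blocks charges
each [a i] at most once. *)
Lemma tail_block_bound (R : rcfType) (I : finType) (a : I -> R) (k : nat)
    (N : {set I} -> R) (c : R) :
  (0 < k)%N -> 0 <= c -> (forall i, 0 <= a i) ->
  (forall T S : {set I}, T \subset S -> N S <= N T + N (S :\: T)) ->
  (forall T : {set I}, (#|T| <= k)%N ->
     N T <= c * Num.sqrt (\sum_(i in T) a i ^+ 2)) ->
  forall S : {set I}, exists T : {set I}, [/\ T \subset S, (#|T| <= k)%N &
    N (S :\: T) <= c * ((\sum_(i in S) a i) / Num.sqrt k%:R)].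
Proof.
move=> k0 c0 a0 Nsub Nblock S.
have kR0 : 0 < k%:R :> R by rewrite ltr0n.
elim/ltn_ind: {S}#|S| {-2}S (erefl #|S|) => p IHp S Sp.
have [Sk|kS] := leqP #|S| k.
  exists S; split => //; rewrite finset.setDv.
  apply: le_trans (Nblock finset.set0 _) _; first by rewrite cards0.
  rewrite big_set0 sqrtr0 mulr0.
  by apply/mulr_ge0 => //; apply/divr_ge0; rewrite ?sqrtr_ge0 ?sumr_ge0.
have [T [TS Tk Ta]] := @top_subset R I a S k (ltnW kS).
have [|U [US Uk NU]] := IHp #|S :\: T| _ (S :\: T) (erefl _).
  by rewrite -Sp cardsD (finset.setIidPr TS) Tk -subn_gt0 subKn // ltnW.
exists T; split; rewrite ?Tk //.
apply: le_trans (Nsub _ _ US) _.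
have Ubound : N U <= c * ((\sum_(i in T) a i) / Num.sqrt k%:R).
  apply: le_trans (Nblock U Uk) _; rewrite ler_wpM2l //.
  pose mu := (\sum_(i in T) a i) / k%:R.
  have mu0 : 0 <= mu by rewrite divr_ge0 ?sumr_ge0 ?ler0n.
  have a_mu j : j \in U -> a j <= mu.
    move=> jU; rewrite ler_pdivlMr // -Tk -[_%:R]mulr1 mulr_natl mulrnAr mulr1.
    rewrite -sumr_const; apply: ler_sum => i iT; apply: Ta => //.
    exact: (fintype.subsetP US).
  apply: le_trans (_ : Num.sqrt (k%:R * mu ^+ 2) <= _).
    apply: ler_wsqrtr; apply: le_trans (_ : \sum_(i in U) mu ^+ 2 <= _).
      by apply: ler_sum => i /a_mu ai; rewrite ler_sqr ?nnegrE.
    by rewrite sumr_const mulr_natl ler_wpMn2l ?sqr_ge0.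
  rewrite sqrtrM ?(ltW kR0) // sqrtr_sqr ger0_norm // /mu.
  have q0 : Num.sqrt k%:R != 0 :> R by rewrite gt_eqF ?sqrtr_gt0.
  rewrite -[X in _ / X]sqr_sqrtr ?(ltW kR0) //.
  by rewrite -subr_ge0 (_ : _ - _ = 0) //; field.
apply: le_trans (lerD Ubound NU) _.
rewrite -mulrDr ler_wpM2l // -mulrDl ler_wpM2r ?invr_ge0 ?sqrtr_ge0 //.
by rewrite [leRHS](big_setID T) /= (finset.setIidPr TS).
Qed.

(** [X1] is the part of [X] carried by its [k] largest singular values. *)
Lemma block_decomposition (R : realType) (m n p k : nat)
    (A : {linear 'M[R]_(m, n) -> 'cV[R]_p}) (c : R) (X : 'M[R]_(m, n)) :
  (0 < k)%N -> 0 <= c ->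
  (forall Z, (\rank Z <= k)%N ->
     euclidean_norm (A Z) <= c * frobenius_norm Z) ->
  exists X1 X2, [/\ X = X1 + X2, (\rank X1 <= k)%N,
    exists M, X1 = X *m M *m X &
    euclidean_norm (A X2) <= c * (nuclear_norm X / Num.sqrt k%:R)].
Proof.
move=> k0 c0 Ac; have [P [s Xs]] := left_svd_exists X.
have s0 i : 0 <= s i by case: Xs.
pose part (T : {set 'I_m}) := reweight X P (fun i => (i \in T)%:R).
have partD (T S : {set 'I_m}) : T \subset S -> part S = part T + part (S :\: T).
  move=> TS; rewrite -reweightD; congr reweight; apply/funext => i.
  rewrite finset.in_setD; have := fintype.subsetP TS i.
  by case: (i \in T) => [->|_] //=; rewrite ?addr0 ?add0r.
have rank_part T : (\rank (part T) <= #|T|)%N.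
  apply: leq_trans (rank_reweight _ _ _) _; apply/eq_leq/eq_card => i.
  by rewrite !inE pnatr_eq0 eqb0 negbK.
have [||T [_ Tk AT]] := @tail_block_bound R 'I_m s k
    (fun T => euclidean_norm (A (part T))) c k0 c0 s0 _ _ [set: 'I_m]%SET.
- move=> T S TS; rewrite (partD _ _ TS) linearD !euclidean_normE.
  exact: frobenius_normD.
- move=> T Tk; apply: le_trans (Ac _ (leq_trans (rank_part T) Tk)) _.
  rewrite ler_wpM2l // -[leLHS]ger0_norm ?frobenius_norm_ge0 // -sqrtr_sqr.
  apply: ler_wsqrtr; rewrite frobenius_norm_sqr (inner_reweight Xs).
  rewrite [leRHS]big_mkcond; apply: ler_sum => i _.
  by case: (i \in T); rewrite ?mul1r ?mulr1 ?mulr0.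
exists (part T), (part ([set: 'I_m]%SET :\: T)); split.
- rewrite -partD ?finset.subsetT // -{1}(reweight1 Xs); congr reweight.
  by apply/funext => i; rewrite finset.in_setT.
- exact: leq_trans (rank_part T) Tk.
- exact: (reweight_sandwich Xs).
- rewrite (nuclear_norm_svd Xs); apply: le_trans AT _.
  by under eq_bigl => i do rewrite finset.in_setT.
Qed.

(** * Recovery from the restricted isometry property *)

(** With [W] the polar factor of [X], [Hc] is [H] multiplied on both sides by the
projections [1 - W W^T] and [1 - W^T W].  With [K = H - W W^T H], each of the two
terms of [H0 = W W^T H + K W^T W] has rank at most that of [X].  The last property
covers all [Hc M Hc] because the leading block of [Hc] has this form. *)
Lemma tangent_decomposition (R : realType) (m n : nat) (X H : 'M[R]_(m, n)) :
  exists H0 Hc, [/\ H = H0 + Hc, (\rank H0 <= 2 * \rank X)%N,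
    X^T *m Hc = 0, X *m Hc^T = 0 & forall M, inner H0 (Hc *m M *m Hc) = 0].
Proof.
have [W [isoW _ [WX XW] [M WE] _]] := polar_factor X.
have rW : (\rank W <= \rank X)%N by rewrite WE mxrankM_maxr.
pose K := H - W *m (W^T *m H).
pose Hc := K - K *m W^T *m W.
have WK : W^T *m K = 0.
  rewrite /K mulmxBr !mulmxA -{1}isoW !trmx_mul trmxK !mulmxA subrr //.
have WHc : W^T *m Hc = 0 by rewrite /Hc mulmxBr !mulmxA WK !mul0mx subrr.
have HcW : Hc *m W^T = 0.
  by rewrite /Hc mulmxBl -{1}isoW !trmx_mul trmxK !mulmxA subrr.
exists (W *m (W^T *m H) + K *m W^T *m W), Hc; split.
- by rewrite /Hc /K addrACA subrr addr0 addrC subrK.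
- apply: leq_trans (mxrank_add _ _) _; rewrite mul2n -addnn leq_add //.
    exact: leq_trans (mxrankM_maxl _ _) rW.
  exact: leq_trans (mxrankM_maxr _ _) rW.
- by rewrite -WX !trmx_mul trmxK -!mulmxA WHc !mulmx0.
- rewrite -XW -(mulmxA X) -mulmxA.
  by rewrite -[W^T *m W *m Hc^T]mulmxA -[W]trmxK -trmx_mul HcW trmx0 !mulmx0.
move=> N; rewrite innerDl /inner !trmx_mul.
have HcW' : W *m Hc^T = 0 by rewrite -[W]trmxK -trmx_mul HcW trmx0.
have WHc' : Hc^T *m W = 0 by rewrite -[W]trmxK -trmx_mul WHc trmx0.
rewrite -!mulmxA (mulmxA W Hc^T) HcW' mul0mx !mulmx0 mxtrace0 addr0.
by rewrite mxtrace_mulC -!mulmxA WHc' !mulmx0 mxtrace0.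
Qed.

(** The block length [3r] balances two demands: the ranks [2r] of [H0] and [3r] of
[H1] must add up to at most [5r], and [11/10 sqrt (2/3)], coming from the tail,
must be less than [9/10]. *)
Lemma nuclear_recovery (R : realType) (m n p r : nat)
    (A : {linear 'M[R]_(m, n) -> 'cV[R]_p}) (X0 Y : 'M[R]_(m, n)) :
  (0 < r)%N -> (\rank X0 <= r)%N ->
  (forall Z, (\rank Z <= 5 * r)%N ->
    9 / 10 * frobenius_norm Z <= euclidean_norm (A Z)
      <= 11 / 10 * frobenius_norm Z) ->
  A Y = A X0 -> nuclear_norm Y <= nuclear_norm X0 -> Y = X0.
Proof.
move=> r0 rX0 rip AY leY.
have [H0 [Hc [YE rH0 X0tHc X0Hct ortho]]] := tangent_decomposition X0 (Y - X0).
have rR : 0 < r%:R :> R by rewrite ltr0n.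
have cone : nuclear_norm Hc <= nuclear_norm H0.
  have := nuclear_norm_add_orthogonal H0 X0tHc X0Hct.
  by rewrite -addrA (addrC Hc) -YE addrC subrK; lra.
have [|||H1 [H2 [HcE rH1 [M H1E] tail]]] :=
    @block_decomposition R m n p (3 * r) A (11 / 10) Hc _ _ _.
- by rewrite muln_gt0.
- by rewrite divr_ge0.
- move=> Z rZ; have /rip/andP[] // : (\rank Z <= 5 * r)%N.
  by rewrite (leq_trans rZ) // leq_mul2r orbT.
have lower : 9 / 10 * frobenius_norm H0 <= euclidean_norm (A H2).
  have -> : euclidean_norm (A H2) = euclidean_norm (A (H0 + H1)).
    have -> : H0 + H1 = Y - X0 - H2 by rewrite YE HcE addrA addrK.
    by rewrite !linearB /= AY subrr sub0r !euclidean_normE frobenius_normN.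
  apply: le_trans (_ : 9 / 10 * frobenius_norm (H0 + H1) <= _).
    by rewrite ler_wpM2l ?divr_ge0 // H1E frobenius_norm_le_orthogonal.
  have rank01 : (\rank (H0 + H1)%R <= 5 * r)%N.
    apply: leq_trans (mxrank_add _ _) _; rewrite -[5%N]/(2 + 3)%N mulnDl.
    by rewrite leq_add // (leq_trans rH0) // leq_mul2l.
  by have /andP[] := rip _ rank01.
have nucH0 : nuclear_norm H0 <= Num.sqrt (2 * r%:R) * frobenius_norm H0.
  apply: le_trans (nuclear_norm_le_frobenius H0) _.
  rewrite ler_wpM2r ?frobenius_norm_ge0 // ler_wsqrtr // -natrM ler_nat.
  by rewrite (leq_trans rH0) // leq_mul2l.
(* sqrt (2/3) is about 0.8165, and 0.817 still satisfies
   11/10 * 0.817 < 9/10. *)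
have ratio : Num.sqrt (2 * r%:R) / Num.sqrt (3 * r%:R) <= 817 / 1000 :> R.
  rewrite ler_pdivrMr ?sqrtr_gt0 ?mulr_gt0 //.
  have r3 : 0 <= 3 * r%:R :> R by rewrite mulr_ge0 // ltW.
  have c0 : 0 <= 817 / 1000 * Num.sqrt (3 * r%:R) :> R.
    by apply: mulr_ge0; rewrite ?sqrtr_ge0 ?divr_ge0.
  rewrite -[leRHS](ger0_norm c0) -sqrtr_sqr; apply: ler_wsqrtr.
  by rewrite exprMn sqr_sqrtr //; lra.
have s3 : 0 < (Num.sqrt (3 * r%:R))^-1 :> R.
  by rewrite invr_gt0 sqrtr_gt0 mulr_gt0.
have F0 := frobenius_norm_ge0 H0.
have H00 : H0 = 0.
  apply: frobenius_norm_eq0; apply/eqP; rewrite eq_le F0 andbT.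
  rewrite natrM in tail.
  have : nuclear_norm Hc / Num.sqrt (3 * r%:R) <=
      817 / 1000 * frobenius_norm H0.
    apply: le_trans (_ : Num.sqrt (2 * r%:R) * frobenius_norm H0 /
      Num.sqrt (3 * r%:R) <= _).
      by rewrite ler_wpM2r ?(ltW s3) // (le_trans cone).
    by rewrite mulrAC ler_wpM2r.
  by move: lower tail; lra.
have Hc0 : Hc = 0.
  apply: nuclear_norm_eq0; apply: le_trans cone (le_trans nucH0 _).
  rewrite H00 (_ : frobenius_norm _ = 0) ?mulr0 //; apply/eqP.
  by rewrite -sqrf_eq0 frobenius_norm_sqr /inner mul0mx mxtrace0.
by apply/eqP; rewrite -subr_eq0 YE H00 Hc0 addr0.
Qed.

Theorem theorem3p3 (R : realType) (m n p r : nat) (hmn : (m <= n)%N)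
  (A : {linear 'M[R]_(m, n) -> 'cV[R]_p}) (X0 : 'M[R]_(m, n))
  (hrank : \rank X0 = r) (b : 'cV[R]_p) (hb : b = A X0)
  (hr : (1 <= r)%N) (h5r : (5 * r <= m)%N)
  (hric : ric A (5 * r)%N < 1 / 10) :
  nuclear_argmin A b = [set X0].
Proof.
have m0 : (0 < m)%N by apply: leq_trans h5r; rewrite muln_gt0.
have [bounds _] : isometry_bounds A (5 * r) (ric A (5 * r)) /\
    lbound (isometry_bounds A (5 * r)) (ric A (5 * r)).
  by apply: ric_min; rewrite ?muln_gt0 // (leq_trans m0).
have recovery Y : A Y = b -> nuclear_norm Y <= nuclear_norm X0 -> Y = X0.
  rewrite hb; apply: (@nuclear_recovery R m n p r) => // [|Z rZ].
    by rewrite hrank.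
  have /andP[lo up] := bounds Z rZ; have Z0 := frobenius_norm_ge0 Z.
  apply/andP; split; [apply: le_trans lo|apply: le_trans up _];
    by rewrite ler_wpM2r //; lra.
rewrite eqEsubset; split => [X [AX minX]|_ ->] /=.
  by apply: recovery => //; apply: minX; rewrite hb.
split => // Y AY; have [//|ltY] := leP (nuclear_norm X0) (nuclear_norm Y).
by move: (ltY); rewrite (recovery Y AY (ltW ltY)) ltxx.
Qed.
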